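(* Let $K$ be a field, $\Delta$ a simplicial complex on $[n]$, and $\Delta^*$ the simplicial complex whose facets are the minimal vertex covers of $\Delta$. Assume that $\Delta$ has no special odd cycle. Then the vertex cover algebra $A(\Delta^* )$ is a standard graded algebra.
   Context: $\mathbb{N}=\{0,1,2,\ldots\}$ and $[n]=\{1,\ldots,n\}$. A simplicial complex on $[n]$ is a collection of subsets of $[n]$ (faces) closed under taking subsets; its maximal faces are its facets, and $\mathcal{F}(\Delta)$ is the set of facets. Complexes have at least one facet and their facets are nonempty. A vertex cover of $\Delta$ is a subset $C\subseteq[n]$ with $C\cap F\ne\emptyset$ for all $F\in\mathcal{F}(\Delta)$; minimal means minimal under inclusion. For $k\ge 0$, a vector $\mathbf{c}=(c_1,\ldots,c_n)\in\mathbb{N}^n$ is a $k$-cover of a simplicial complex $\Sigma$ on $[n]$ if $\sum_{i\in F}c_i\ge k$ for all $F\in\mathcal{F}(\Sigma)$. Let $S=K[x_1,\ldots,x_n]$, let $t$ be a new variable, and let $A_k(\Sigma)$ be the $K$-span of all monomials $x_1^{c_1}\cdots x_n^{c_n}t^k$ with $(c_1,\ldots,c_n)$ a $k$-cover of $\Sigma$. The vertex cover algebra is the graded $S$-algebra $A(\Sigma)=\bigoplus_{k\ge 0}A_k(\Sigma)\subseteq S[t]$ (so $A_0(\Sigma)=S$). It is called standard graded if it is generated over $S$ by $A_1(\Sigma)$. An $s$-cycle of $\Delta$ ($s\ge2$) is an alternating sequence $v_1,F_1,v_2,F_2,\ldots,v_s,F_s,v_{s+1}=v_1$ with $v_1,\ldots,v_s$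 distinct vertices and $F_1,\ldots,F_s$ distinct facets of $\Delta$ such that $v_i,v_{i+1}\in F_i$ for $i=1,\ldots,s$. The cycle is special if none of its facets $F_1,\ldots,F_s$ contains more than two of the vertices $v_1,\ldots,v_s$. It is odd if $s$ is odd. *)

(* Defs.v *)
From HB Require Import structures.
From mathcomp Require Import all_boot all_order all_algebra.
From mathcomp Require Import mpoly.

Set Implicit Arguments.
Unset Strict Implicit.
Unset Printing Implicit Defensive.

Import GRing.Theory.
Local Open Scope ring_scope.

Definition facets_of (n : nat) (X : {set {set 'I_n}}) : {set {set 'I_n}} :=
  [set F | maxset (fun G => G \in X) F].

(* The vertex set [n] is 'I_n; a vertex need not itself be a face. *)
Record simplicial_complex (n : nat) := SimplicialComplex {
  faces : {set {set 'I_n}};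
  faces_closed : forall F G : {set 'I_n},
    F \in faces -> G \subset F -> G \in faces;
  facets_neq0 : facets_of faces != set0;
  facet_neq0 : forall F : {set 'I_n}, F \in facets_of faces -> F != set0 }.

Definition facets (n : nat) (D : simplicial_complex n) : {set {set 'I_n}} :=
  facets_of (faces D).

Definition vertex_cover (n : nat) (D : simplicial_complex n)
    (C : {set 'I_n}) : bool :=
  [forall F in facets D, C :&: F != set0].

Definition minimal_vertex_covers (n : nat) (D : simplicial_complex n) :
    {set {set 'I_n}} :=
  [set C | minset (vertex_cover D) C].

Definition dual_faces (n : nat) (D : simplicial_complex n) :
    {set {set 'I_n}} :=
  [set G : {set 'I_n} | [exists C in minimal_vertex_covers D, G \subset C]].

Lemma facets_of_dual_faces (n : nat) (D : simplicial_complex n) :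
  facets_of (dual_faces D) = minimal_vertex_covers D.
Proof.
apply/setP => C; rewrite inE; apply/idP/idP.
  case/maxsetP; rewrite inE => /exists_inP[B mB sCB] maxC.
  suff <- : B = C by [].
  by apply: maxC => //; rewrite inE; apply/exists_inP; exists B.
move=> mC; apply/maxsetP; split.
  by rewrite inE; apply/exists_inP; exists C.
move=> B; rewrite inE => /exists_inP[B' mB' sBB'] sCB.
have eCB' : C = B'.
  move: mC mB'; rewrite !inE => /minsetp vC mB'.
  exact: (minsetinf mB' vC (subset_trans sCB sBB')).
by apply/eqP; rewrite eqEsubset sCB andbT eCB'.
Qed.

Lemma dual_faces_closed (n : nat) (D : simplicial_complex n)
    (F G : {set 'I_n}) :
  F \in dual_faces D -> G \subset F -> G \in dual_faces D.
Proof.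
rewrite !inE => /exists_inP[C mC sFC] sGF.
by apply/exists_inP; exists C => //; apply: subset_trans sFC.
Qed.

Lemma dual_facets_neq0 (n : nat) (D : simplicial_complex n) :
  facets_of (dual_faces D) != set0.
Proof.
rewrite facets_of_dual_faces; apply/set0Pn.
have vT : vertex_cover D setT.
  by apply/forall_inP => F /facet_neq0; rewrite setTI.
by have [C mC _] := minset_exists vT; exists C; rewrite inE.
Qed.

Lemma dual_facet_neq0 (n : nat) (D : simplicial_complex n) (C : {set 'I_n}) :
  C \in facets_of (dual_faces D) -> C != set0.
Proof.
rewrite facets_of_dual_faces inE => /minsetp/forall_inP vC.
have /set0Pn[F /vC] := facets_neq0 D.
by apply: contra_neq => ->; rewrite set0I.
Qed.

Definition dual_complex (n : nat) (D : simplicial_complex n) :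
    simplicial_complex n :=
  SimplicialComplex (@dual_faces_closed n D) (dual_facets_neq0 D)
    (@dual_facet_neq0 n D).

Lemma facets_dual (n : nat) (D : simplicial_complex n) :
  facets (dual_complex D) = minimal_vertex_covers D.
Proof. exact: facets_of_dual_faces. Qed.

(* Cyclic sequences of length s are indexed by 'I_s, and ordS is the successor
   modulo s, so that v (ordS i) is v_{i+1} with v_{s+1} = v_1. *)
Definition is_cycle (n : nat) (D : simplicial_complex n) (s : nat)
    (v : 'I_s -> 'I_n) (F : 'I_s -> {set 'I_n}) : Prop :=
  [/\ (2 <= s)%N, injective v, injective F,
      forall i, F i \in facets D
    & forall i, v i \in F i /\ v (ordS i) \in F i].

Definition special (n s : nat) (v : 'I_s -> 'I_n)
    (F : 'I_s -> {set 'I_n}) : Prop :=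
  forall i, (#|F i :&: [set v j | j : 'I_s]| <= 2)%N.

Definition has_special_odd_cycle (n : nat) (D : simplicial_complex n) : Prop :=
  exists (s : nat) (v : 'I_s -> 'I_n) (F : 'I_s -> {set 'I_n}),
    [/\ is_cycle D v F, special v F & odd s].

Definition k_cover (n : nat) (D : simplicial_complex n) (k : nat)
    (c : 'X_{1..n}) : bool :=
  [forall F in facets D, (k <= \sum_(i in F) c i)%N].

(* S is {mpoly K[n]}, S[t] is {poly {mpoly K[n]}}, and the monomial x^c t^k is
   'X_[c] *: 'X^k. *)
Definition cover_component (K : fieldType) (n : nat) (D : simplicial_complex n)
    (k : nat) (p : {poly {mpoly K[n]}}) : Prop :=
  exists2 s : seq (K * 'X_{1..n}), all (fun x => k_cover D k x.2) s
    & p = \sum_(x <- s) (x.1 *: 'X_[x.2]) *: 'X^k.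

Definition vertex_cover_algebra (K : fieldType) (n : nat)
    (D : simplicial_complex n) (p : {poly {mpoly K[n]}}) : Prop :=
  exists (N : nat) (q : nat -> {poly {mpoly K[n]}}),
    (forall k, cover_component D k (q k)) /\ p = \sum_(k < N) q k.

Inductive generated_subalgebra (R : comNzRingType) (A : algType R)
    (G : A -> Prop) : A -> Prop :=
| gen_mem u : G u -> generated_subalgebra G u
| gen_one : generated_subalgebra G 1
| gen_linear (a : R) u v : generated_subalgebra G u ->
    generated_subalgebra G v -> generated_subalgebra G (a *: u + v)
| gen_mul u v : generated_subalgebra G u ->
    generated_subalgebra G v -> generated_subalgebra G (u * v).

Definition standard_graded (K : fieldType) (n : nat)
    (D : simplicial_complex n) : Prop :=
  forall p : {poly {mpoly K[n]}},
    vertex_cover_algebra D p <-> generated_subalgebra (cover_component D 1) p.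

(* Main.v *)
Require Import Defs.
From mathcomp Require Import all_boot all_order all_algebra.
From mathcomp Require Import mpoly.
From mathcomp Require Import zify.

Set Implicit Arguments.
Unset Strict Implicit.
Unset Printing Implicit Defensive.

(** A complex without special odd cycles has for facets a balanced hypergraph
in the sense of Berge, and a 1-cover of [dual_complex D] is a weight whose
support meets every minimal vertex cover of [D], that is, contains a facet.
So the theorem is a max-flow min-cut property: if every vertex cover has
[c]-weight at least [k], then [k] facets, repetitions allowed, can be packed
in [c] ([packing]).  Given such facets, x^c t^k is a monomial of [S] times the
product of the [k] elements x^F t, each of degree 1 in the algebra.

The packing is found without linear programming, from the colouring theory of
balanced hypergraphs.  The vertices of a balanced hypergraph can be coloured
with two colours so that every edge with at least two vertices sees both
([bicoloring]).  Recolouring two classes at a time turns this into: a weight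
giving at least [k] to every edge dominates a sum of [k] vertex covers
([cover_decomposition]).  Hence, if all vertex covers have weight at least [m],
then a weight that gives at least [k] to every edge pairs to at least [k * m]
([multicover_weight]).

For the packing, remove an edge [F] and use induction: it suffices to find a
multiplicity [q] of [F] such that the rest of the capacity, [c - q F], gives
weight at least [k - q] to the vertex covers of the other edges.  A
multiplicity fails either because it is too small, which is witnessed by a
vertex cover [C0] of the other edges that avoids [F], or because it is too
large, witnessed by some [C1] that meets [F] in [t >= 2] vertices.  If no
multiplicity works, then [q] fails on one side and [q + 1] on the other, and
the weight [(t - 1) C0 + C1], which is at least [t] on each edge, contradicts
[multicover_weight] by one unit. *)

(** * Balanced hypergraphs and bicolourings *)

Section Hypergraph.
Variable T : finType.
Implicit Types (H : {set {set T}}) (W C F : {set T}) (e : rel T).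

Definition odd_special_cycle H (s : nat) (v : 'I_s -> T)
    (F : 'I_s -> {set T}) : Prop :=
  [/\ (2 <= s)%N, injective v /\ injective F,
      forall i, [/\ F i \in H, v i \in F i & v (ordS i) \in F i],
      forall i, (#|F i :&: [set v j | j : 'I_s]| <= 2)%N & odd s].

Definition balanced H : Prop :=
  forall s (v : 'I_s -> T) (F : 'I_s -> {set T}), ~ odd_special_cycle H v F.

Lemma balancedS H1 H2 : H1 \subset H2 -> balanced H2 -> balanced H1.
Proof.
move=> /subsetP sH bal s v F [s2 inj inc spec odds]; apply: (bal s v F).
by split=> // i; have [/sH FH vi vj] := inc i.
Qed.

(** The start of a path that cannot be extended has all its neighbours on that
path.  In [bicoloring] this provides a vertex whose removal leaves its
neighbours connected to each other. *)
Lemma maximal_path e (x : T) :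
  exists v p, [/\ path e v p, uniq (v :: p), last v p = x
                & forall y, e y v -> y \in v :: p].
Proof.
suff: forall m v p, path e v p -> uniq (v :: p) -> (#|T| <= size p + m)%N ->
    exists v' p', [/\ path e v' p', uniq (v' :: p'), last v' p' = last v p
                    & forall y, e y v' -> y \in v' :: p'].
  by move=> /(_ #|T| x [::]); apply.
elim=> [|m IH] v p ep up sz.
  have := leq_trans (max_card (mem (v :: p))) sz.
  by rewrite (card_uniqP up) /= addn0 ltnn.
case: (pickP (fun y => e y v && (y \notin v :: p))) => [y /andP[eyv yp]|nop].
  have [||| v' [p' H']] := IH y (v :: p); last by exists v', p'.
  - by rewrite /= eyv.
  - by rewrite cons_uniq yp.
  - by rewrite /= addSnnS.
exists v, p; split=> // y eyv.
by have := nop y; rewrite eyv /= => /negbFE.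
Qed.

(** The graph of the edges of [H] whose trace on [W] is a pair: these are the
edges that force two vertices of [W] to have different colours. *)
Definition link H W : rel T :=
  [rel x y | (x != y) && [exists F in H, F :&: W == [set x; y]]].

Lemma succ_mod_asym s a b : (2 < s -> a < s -> b < s ->
  b = a.+1 %% s -> a = b.+1 %% s -> False)%N.
Proof.
have succE x : (x < s -> x.+1 %% s = if x.+1 == s then 0 else x.+1)%N.
  by case: eqP => [-> | ne lt]; rewrite ?modnn // modn_small //; lia.
by move=> s2 lta ltb; rewrite !succE //; do 2!case: eqP; lia.
Qed.

(** The edges that realise a cycle of this graph have only two vertices in [W],
so they form a special cycle; they are distinct because a cycle of length at
least 3 does not use the same pair twice. *)
Lemma link_cycle H W (q : seq T) :
  balanced H -> uniq q -> cycle (link H W) q -> (2 < size q)%N ->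
  ~~ odd (size q).
Proof.
move=> bal uq cq q2; apply/negP => oddq.
have x0 : T by case: q q2 {uq cq oddq}.
pose s := size q; pose v (i : 'I_s) := nth x0 q i.
have vinj : injective v.
  by move=> i j /eqP; rewrite nth_uniq // => /eqP/val_inj.
have vS i : v (ordS i) = next q (v i).
  rewrite next_nth mem_nth // index_uniq // /v.
  case: q @s {uq cq oddq vinj} @v i q2 => // y p s v i _; rewrite [LHS]/=.
  have [lt|ge] := ltnP i (size p).
    by rewrite modn_small //= (set_nth_default y).
  have -> : i = size p :> nat by apply/eqP; rewrite eqn_leq ge andbT; exact: (ltn_ord i).
  by rewrite /s /= modnn /= nth_default.
have vW i : link H W (v i) (v (ordS i)).
  by rewrite vS; apply: next_cycle cq (mem_nth x0 (ltn_ord i)).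
have exF i : exists F, (F \in H) && (F :&: W == [set v i; v (ordS i)]).
  by have /andP[_ /exists_inP[F FH FW]] := vW i; exists F; rewrite FH.
pose F i := xchoose (exF i).
have FH i : F i \in H by have /andP[] := xchooseP (exF i).
have FW i : F i :&: W = [set v i; v (ordS i)].
  by have /andP[_ /eqP] := xchooseP (exF i).
have inFW i j : (v j \in F i :&: W) = (j == i) || (j == ordS i).
  by rewrite FW !inE !(inj_eq vinj).
have vinW j : v j \in W by have := inFW j j; rewrite eqxx /= inE => /andP[].
apply: (bal s v F); split=> //.
- by rewrite /s; lia.
- split=> // i j eF; apply/eqP; apply: contraT => nij.
  have := inFW i i; rewrite eF inFW eqxx /= (negPf nij) /= => /eqP ij.
  have := inFW i j; rewrite eF inFW eqxx /= eq_sym (negPf nij) /= => /esym/eqP ji.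
  by case: (succ_mod_asym q2 (ltn_ord i) (ltn_ord j) (congr1 val ji)
            (congr1 val ij)).
- move=> i; have [] := (inFW i i, inFW i (ordS i)); rewrite !eqxx orbT !inE.
  by case/andP=> -> _ /andP[].
- move=> i; apply: leq_trans (_ : #|F i :&: W| <= 2)%N.
    apply/subset_leq_card/setIS/subsetP => _ /imsetP[j _ ->]; exact: vinW.
  by rewrite FW cards2; case: (_ != _).
Qed.

(** Induction on [W], removing the start [v] of a maximal path of the graph
[link H W].  A colouring of [W :\ v] alternates along the rest of the path, so
two neighbours of [v] have the same colour: otherwise [v] and a segment of the
path form an odd cycle.  Giving [v] the other colour settles the edges that
meet [W] in [v] and one neighbour; the other edges are already bicoloured. *)
Lemma bicoloring H W : balanced H ->
  exists f : T -> bool, forall F, F \in H -> (2 <= #|F :&: W|)%N ->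
    forall b, exists2 x, x \in F :&: W & f x = b.
Proof.
move=> bal; move: {2}#|W| (erefl #|W|) => m; elim: m W => [|m IH] W cW.
  exists xpredT => F _; rewrite (cards0_eq cW) setI0 cards0; lia.
have /set0Pn[x xW] : W != set0 by rewrite -card_gt0 cW.
have [v [p [ep up px maxp]]] := maximal_path (link H W) x.
have linkW y z : link H W y z -> y \in W.
  case/andP=> _ /exists_inP[F _ /eqP FW].
  by have : y \in F :&: W by [rewrite FW !inE eqxx|]; rewrite inE => /andP[].
have vW : v \in W.
  by case: p ep px {up maxp} => [_ /= -> //|w p /= /andP[/linkW]].
have [|f fP] := IH (W :\ v); first by move: cW; rewrite (cardsD1 v W) vW; lia.
have fD F : F \in H -> (2 <= #|F :&: (W :\ v)|)%N ->
    forall b, exists2 x, x \in F :&: W & (x != v) && (f x == b).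
  move=> FH F2 b; have [y yF fy] := fP F FH F2 b; exists y; move: yF; rewrite !inE.
    by case/and3P => -> _ ->.
  by case/and3P => _ -> _; rewrite fy eqxx.
have alt y z : link H W y z -> y != v -> z != v -> f y != f z.
  case/andP=> nyz /exists_inP[F FH /eqP FW] yv zv.
  have FWv : F :&: (W :\ v) = [set y; z].
    rewrite setIDA FW; apply/setDidPl.
    by rewrite disjoint_sym disjoints1 !inE negb_or ![v == _]eq_sym yv.
  have fb := fP F FH; rewrite FWv cards2 nyz in fb.
  have [x1] := fb isT true; have [x2] := fb isT false.
  by rewrite !inE => /orP[]/eqP-> + /orP[]/eqP->; case: (f y); case: (f z).
pose w := head v p.
have pv i : (i < size p)%N -> nth w p i != v.
  move=> ip; apply: contraTneq (mem_nth w ip) => ->.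
  by move: up => /= /andP[].
have parity i : (i < size p)%N -> f (nth w p i) = f w (+) odd i.
  elim: i => [|i IHi] ip; first by rewrite addbF /w; case: (p) ip.
  have := pathP w ep _ ip => /= lk.
  have := alt _ _ lk (pv _ (ltnW ip)) (pv _ ip); rewrite IHi ?(ltnW ip) //=.
  by case: (f w); case: (odd i); case: (f (nth _ _ _)).
have nbr y : link H W y v -> f y = f w.
  move=> lk; have := maxp y lk; rewrite inE => /predU1P[yv|yp].
    by move: lk; rewrite yv /link /= eqxx.
  have jp : (index y p < size p)%N by rewrite index_mem.
  have := parity _ jp; rewrite nth_index // => ->.
  suff /negbTE -> : ~~ odd (index y p) by rewrite addbF.
  have [-> //|j0] := posnP (index y p).
  have sz : size (v :: take (index y p).+1 p) = (index y p).+2.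
    by rewrite /= size_takel.
  have := @link_cycle H W (v :: take (index y p).+1 p) bal.
  rewrite sz /= negbK; apply=> //; first exact: (take_uniq (index y p).+2 up).
  rewrite rcons_path take_path // (take_nth w jp) last_rcons nth_index // lk.
(* If [p] is empty then [v] has no neighbour and its colour is irrelevant, so
   the default value [w = v] is harmless. *)
exists (fun y => if y == v then ~~ f w else f y) => F FH F2 b.
have [big|small] := leqP 2 #|F :&: (W :\ v)|.
  have [y yF /andP[yv /eqP fy]] := fD F FH big b.
  by exists y => //; rewrite (negPf yv).
have vF : v \in F :&: W.
  apply: contraTT small => vF; rewrite -leqNgt setIDA.
  by have /setDidPl -> : [disjoint F :&: W & [set v]]; rewrite // disjoint_sym disjoints1.
have /cards1P[y yE] : #|(F :&: W) :\ v| == 1%N.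
  by move: F2 small; rewrite setIDA (cardsD1 v (F :&: W)) vF; lia.
have FE : F :&: W = [set v; y] by rewrite -yE setD1K.
have yv : y != v by have := set11 y; rewrite -yE !inE => /andP[].
have fy : f y = f w.
  by apply: nbr; rewrite /link /= yv; apply/exists_inP; exists F; rewrite // FE setUC.
have [->|nb] := eqVneq b (f w).
  by exists y; rewrite ?FE ?(negPf yv) // !inE eqxx orbT.
exists v; first by rewrite FE !inE eqxx.
by rewrite eqxx; case: b (f w) nb => [] [].
Qed.

(** * Decomposition of multicovers *)

Definition weight (c : T -> nat) F : nat := \sum_(x in F) c x.

Lemma weight_gt0 c F : (0 < weight c F)%N = [exists x in F, (0 < c x)%N].
Proof.
apply/idP/exists_inP => [|[x xF cx]]; last by rewrite /weight (bigD1 x) //=; lia.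
rewrite lt0n sum_nat_eq0 negb_forall => /existsP[x].
by rewrite negb_imply -lt0n => /andP[xF cx]; exists x.
Qed.

(** Bicolouring for multisets of vertices.  A vertex of multiplicity at least 2
is given to both parts, which settles all edges through it, so only the
vertices of multiplicity 1 have to be coloured. *)
Lemma weight_split H c : balanced H -> exists a b,
  [/\ forall x, c x = (a x + b x)%N
    & forall F, F \in H -> (2 <= weight c F)%N ->
        (0 < weight a F)%N /\ (0 < weight b F)%N].
Proof.
move=> bal; pose W := [set x | c x == 1%N].
have [f fP] := bicoloring W bal.
pose a x := if (1 < c x)%N then 1%N else (f x * c x)%N.
exists a, (fun x => c x - a x)%N; split=> [x|F FH cF].
  by rewrite /a; case: ltnP; case: (f x); lia.
rewrite !weight_gt0; have [/exists_inP[x xF cx]|] := boolP [exists x in F, (1 < c x)%N].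
  by split; apply/exists_inP; exists x => //; rewrite /a cx; lia.
rewrite negb_exists_in => /forall_inP small.
have cE : weight c F = #|F :&: W|.
  rewrite /weight -sum1_card big_mkcond [RHS]big_mkcond; apply: eq_bigr => x _.
  by rewrite !inE; case: ifP => // /small; case: (c x) => [|[]].
rewrite cE in cF; split; apply/exists_inP.
  have [x] := fP F FH cF true; rewrite !inE => /andP[xF /eqP cx] fx.
  by exists x; rewrite // /a cx fx.
have [x] := fP F FH cF false; rewrite !inE => /andP[xF /eqP cx] fx.
by exists x; rewrite // /a cx fx.
Qed.

Definition hits H C : bool := [forall F in H, C :&: F != set0].

(** Write [c] as a sum of [k] weights and let the score count the pairs of an
edge and a part that is nonzero on it.  If a part vanishes on an edge then,
since that edge has weight at least [k], another part is at least 2 on it;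
splitting the sum of these two parts anew by [weight_split] increases the
score, which is bounded. *)
Lemma cover_decomposition H c k : balanced H ->
    (forall F, F \in H -> (k <= weight c F)%N) ->
  exists2 C : 'I_k -> {set T}, forall i, hits H (C i)
    & forall x, (\sum_i (x \in C i) <= c x)%N.
Proof.
move=> bal; case: k => [|k] cH.
  by exists (fun _ => setT) => [[]|x] //; rewrite big_ord0.
pose seen (d : 'I_k.+1 -> T -> nat) F := \sum_i (0 < weight (d i) F)%N.
pose score d := \sum_(F in H) seen d F.
suff: forall m d, (forall x, \sum_i d i x = c x)%N -> (k.+1 * #|H| < score d + m)%N ->
    exists2 d' : 'I_k.+1 -> T -> nat, forall x, (\sum_i d' i x = c x)%N
     & forall i F, F \in H -> (0 < weight (d' i) F)%N.
  case/(_ (k.+1 * #|H|).+1 (fun i x => if i == ord0 then c x else 0%N)).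
  - by move=> x; rewrite -big_mkcond big_pred1_eq.
  - by rewrite addnS ltnS leq_addl.
  move=> d dc dH; exists (fun i => [set x | 0 < d i x]%N) => [i|x].
    apply/forall_inP => F /(dH i); rewrite weight_gt0 => /exists_inP[x xF dx].
    by apply/set0Pn; exists x; rewrite !inE dx.
  by rewrite -dc; apply: leq_sum => i _; rewrite inE; case: (d i x).
elim=> [|m IH] d dc sz.
  have : (score d <= \sum_(F in H) k.+1)%N.
    apply: leq_sum => F _; rewrite -[X in (_ <= X)%N]card_ord -sum1_card.
    by apply: leq_sum => i _; case: (0 < _)%N.
  by rewrite sum_nat_const; move: sz; lia.
have [/forallP ok|] := boolP [forall i, forall F in H, (0 < weight (d i) F)%N].
  by exists d => // i F FH; have /forall_inP := ok i; apply.
rewrite negb_forall => /existsP[i]; rewrite negb_forall_in => /exists_inP[F0 F0H].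
rewrite -eqn0Ngt => /eqP di0.
have dsum F : weight c F = \sum_i weight (d i) F.
  by rewrite /weight exchange_big /=; apply: eq_bigr => x _; rewrite dc.
have [j dj] : exists j, (2 <= weight (d j) F0)%N.
  apply/existsP; apply: contraT; rewrite negb_exists => /forallP small.
  have := cH F0 F0H; rewrite dsum (bigD1 i) //= di0 add0n.
  apply: contraLR => _; rewrite -leqNgt.
  apply: (@leq_trans (\sum_(l | l != i) 1)%N).
    by apply: leq_sum => l _; rewrite leqNgt.
  by rewrite sum1_card cardC1 card_ord.
have nij : i != j by apply: contraTneq dj => <-; rewrite di0.
have [a [b [ab abH]]] := weight_split (fun x => d i x + d j x)%N bal.
(* Edges of weight at most 1 in [d i + d j] keep their contribution to the
   score, and the others get the largest possible one. *)
pose d' l := if l == i then a else if l == j then b else d l.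
have big2 (h : 'I_k.+1 -> nat) :
    \sum_l h l = (h i + h j + \sum_(l | (l != i) && (l != j)) h l)%N.
  by rewrite (bigD1 i) //= (bigD1 j) 1?eq_sym //= addnA.
have d'i : d' i = a by rewrite /d' eqxx.
have d'j : d' j = b by rewrite /d' eq_sym (negPf nij) eqxx.
have d'l l : (l != i) && (l != j) -> d' l = d l.
  by rewrite /d' => /andP[/negPf -> /negPf ->].
have wab F : (weight (d i) F + weight (d j) F = weight a F + weight b F)%N.
  by rewrite /weight -!big_split; apply: eq_bigr => x _ /=; rewrite ab.
have wd F : weight (fun x => d i x + d j x)%N F = (weight (d i) F + weight (d j) F)%N.
  by rewrite /weight big_split.
have grow F : F \in H -> (seen d F + ((weight (d i) F == 0) && (2 <= weight (d j) F)) <= seen d' F)%N.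
  move=> FH; have := abH F FH; rewrite /seen !big2 d'i d'j wd => ab2.
  rewrite [X in (_ <= _ + X)%N](eq_bigr (fun l => (0 < weight (d l) F) : nat))%N; last first.
    by move=> l /d'l ->.
  have := wab F; move: ab2.
  move: (weight (d i) F) (weight (d j) F) (weight a F) (weight b F) (\sum_(_ | _) _).
  move=> p q r s t; lia.
apply: (IH d').
  move=> x; rewrite -dc !big2 d'i d'j -ab; congr addn.
  by apply: eq_bigr => l /d'l ->.
apply: leq_trans sz _; rewrite addnS -addSn leq_add2r /score.
rewrite (bigD1 F0) //= [X in (_ <= X)%N](bigD1 F0) //= -addSn leq_add //.
  by have := grow F0 F0H; rewrite di0 dj /= addn1.
by apply: leq_sum => F /andP[FH _]; apply: leq_trans (grow F FH); apply: leq_addr.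
Qed.

(** The integrality that replaces linear programming duality in [packing]. *)
Lemma multicover_weight H c w k m : balanced H ->
    (forall F, F \in H -> (k <= weight c F)%N) ->
    (forall C, hits H C -> (m <= weight w C)%N) ->
  (k * m <= \sum_x c x * w x)%N.
Proof.
move=> bal cH wH; have [C CH Cc] := cover_decomposition bal cH.
apply: (@leq_trans (\sum_(i < k) weight w (C i))%N).
  rewrite -[X in (X * _)%N]card_ord -sum_nat_const; apply: leq_sum => i _; exact: wH.
rewrite /weight (exchange_big_dep xpredT) //=; apply: leq_sum => x _.
apply: leq_trans (leq_mul (Cc x) (leqnn (w x))); rewrite big_distrl big_mkcond /=.
by apply: leq_sum => i _; case: ifP; rewrite ?mul1n.
Qed.

(** * Packing edges *)

Lemma weightD c1 c2 F :
  weight (fun x => c1 x + c2 x)%N F = (weight c1 F + weight c2 F)%N.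
Proof. exact: big_split. Qed.

Lemma weight_indicator (q : nat) C F :
  weight (fun x => q * (x \in C))%N F = (q * #|C :&: F|)%N.
Proof.
rewrite /weight -big_distrr /= -sum1_card big_mkcond [in RHS]big_mkcond.
by congr (_ * _)%N; apply: eq_bigr => x _; rewrite inE andbC; do 2!case: (x \in _).
Qed.

(** The max-flow min-cut property of balanced hypergraphs, by induction on the
number of edges.  See the introduction for the argument. *)
Lemma packing H c k : balanced H -> set0 \notin H ->
    (forall C, hits H C -> (k <= weight c C)%N) ->
  exists s : seq {set T}, [/\ size s = k, {subset s <= H}
    & forall x, (\sum_(F <- s) (x \in F) <= c x)%N].
Proof.
move: {2}#|H| (erefl #|H|) => m; elim: m H c k => [|m IH] H c k cardH bal H0 cH.
  have /cH : hits H set0.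
    by apply/forall_inP => F; rewrite (cards0_eq cardH) inE.
  rewrite /weight big_set0 leqn0 => /eqP ->.
  by exists [::]; split=> // x; rewrite big_nil.
have /set0Pn[F FH] : H != set0 by rewrite -card_gt0 cardH.
pose H' := H :\ F.
have hitsE C : hits H' C -> C :&: F != set0 -> hits H C.
  move=> /forall_inP hC CF; apply/forall_inP => G GH.
  by have [-> //|GF] := eqVneq G F; apply: hC; rewrite !inE GF.
(* [q] copies of [F] fit in [c], and what they leave satisfies the hypothesis
   for [H'] and [k - q]; the last inequality avoids subtractions. *)
pose good q := (q <= k)%N && [forall x in F, (q <= c x)%N] &&
  [forall C, hits H' C ==> (k + q * #|C :&: F| <= weight c C + q)%N].
have [[q /andP[/andP[qk /forall_inP qc] /forallP qH]]|nogood] :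
    (exists q, good q) \/ (forall q, ~~ good q).
  have [/existsP[q gq]|] := boolP [exists q : 'I_k.+1, good q].
    by left; exists q.
  rewrite negb_exists => /forallP ng; right=> q.
  have [lt|ge] := ltnP q k.+1; first exact: (ng (Ordinal lt)).
  by rewrite /good leqNgt ge.
  pose c' x := (c x - q * (x \in F))%N.
  have cE x : c x = (c' x + q * (x \in F))%N.
    by rewrite /c'; case: (boolP (x \in F)) => [/qc|]; lia.
  have [||||s [sz sH sc]] := IH H' c' (k - q)%N.
  - by move: cardH; rewrite (cardsD1 F H) FH => -[].
  - exact: balancedS (subsetDl _ _) bal.
  - by rewrite inE (negPf H0) andbF.
  - move=> C hC; have /implyP/(_ hC) := qH C.
    suff -> : weight c C = (weight c' C + q * #|C :&: F|)%N by lia.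
    rewrite setIC -weight_indicator -weightD; exact: eq_bigr.
  exists (nseq q F ++ s); split=> [|G|x].
  - by rewrite size_cat size_nseq sz subnKC.
  - by rewrite mem_cat mem_nseq => /orP[/andP[_ /eqP->]|/sH]; rewrite // inE => /andP[].
  - by rewrite big_cat big_nseq iter_addn_0 /= cE addnC mulnC leq_add.
(* The witnesses that [q] is too small. *)
pose avoids q := [exists C : {set T}, [&& hits H' C, C :&: F == set0 & (weight c C + q < k)%N]].
have av0 : exists q, avoids q.
  have := nogood 0%N; rewrite /good leq0n /= negb_and.
  case/orP => [/negP[]|]; first exact/forall_inP.
  rewrite negb_forall => /existsP[C]; rewrite negb_imply mul0n !addn0 -ltnNge.
  move=> /andP[hC ltC]; exists 0%N; apply/existsP; exists C; rewrite hC addn0 ltC andbT /=.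
  apply: contraLR ltC => /(hitsE _ hC)/cH; lia.
have avb q : avoids q -> (q <= k)%N by case/existsP => C /and3P[_ _]; lia.
case: (ex_maxnP av0 avb) => q /existsP[C0 /and3P[hC0 C0F ltC0]] maxq.
(* The multiplicity [q.+1] still fits in [c]: adding [x] to [C0] gives a vertex
   cover of [H], of weight at least [k]. *)
have qc x : x \in F -> (q < c x)%N.
  move=> xF; have : (k <= weight c (x |: C0))%N.
    apply: cH; apply: hitsE.
      apply/forall_inP => G /(forall_inP hC0); apply: contraNneq => e.
      by rewrite -subset0 -e setSI // subsetUr.
    by apply/set0Pn; exists x; rewrite !inE eqxx.
  have xC0 : x \notin C0.
    by apply/negP => xC0; have := in_set0 x; rewrite -(eqP C0F) inE xC0 xF.
  by rewrite /weight big_setU1 //= -/(weight c C0); lia.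
have := nogood q.+1; rewrite /good negb_and => /orP[|].
  by rewrite negb_and => /orP[|/negP[]]; [lia | apply/forall_inP].
rewrite negb_forall => /existsP[C1]; rewrite negb_imply -ltnNge => /andP[hC1 ltC1].
pose t := #|C1 :&: F|.
have C1F : C1 :&: F != set0.
  apply/eqP => C1F; suff /maxq : avoids q.+1 by rewrite ltnn.
  apply/existsP; exists C1; rewrite hC1 C1F eqxx /=.
  by move: ltC1; rewrite C1F cards0 muln0 addn0.
have ct := cH C1 (hitsE _ hC1 C1F).
(* The case [t = 1] is excluded by [ct]: such a [C1] would have weight below
   [k]. *)
have t2 : (1 < t)%N by move: ltC1; rewrite -/t; case: (t) => [|[]]; lia.
have [u tE] : exists u, t = u.+1 by exists t.-1; rewrite prednK // ltnW.
pose d x := (u * (x \in C0) + 1 * (x \in C1))%N.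
have dH G : G \in H -> (t <= weight d G)%N.
  move=> GH; rewrite weightD !weight_indicator mul1n.
  have [->|GF] := eqVneq G F; first exact: leq_addl.
  have GH' : G \in H' by rewrite !inE GF.
  have := (forall_inP hC0) G GH'; have := (forall_inP hC1) G GH'.
  by rewrite -!card_gt0 tE; nia.
have := multicover_weight bal dH cH.
under eq_bigr => x _ do rewrite mulnDl -!mulnA.
rewrite big_split -!big_distrr /= mul1n.
have sumE C : (\sum_x (x \in C) * c x = weight c C)%N.
  by rewrite /weight [RHS]big_mkcond; apply: eq_bigr => x _; case: ifP; lia.
by rewrite !sumE; move: ltC1; rewrite -/t tE; nia.
Qed.

End Hypergraph.

(** * The vertex cover algebra *)

Import GRing.Theory.
Local Open Scope ring_scope.

Section CoverAlgebra.
Variables (K : fieldType) (n : nat).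
Implicit Types (S D : simplicial_complex n) (p : {poly {mpoly K[n]}}).

Lemma k_coverD S k l (c d : 'X_{1..n}) :
  k_cover S k c -> k_cover S l d -> k_cover S (k + l) (c + d)%MM.
Proof.
move=> /forall_inP ck /forall_inP dl; apply/forall_inP => F FS.
under eq_bigr => i _ do rewrite mnmDE.
by rewrite big_split leq_add ?ck ?dl.
Qed.

Lemma k_cover0 S (c : 'X_{1..n}) : k_cover S 0 c.
Proof. exact/forall_inP. Qed.

(** Membership in the vertex cover algebra, read off the monomials of the
coefficients; see [vertex_cover_algebraP].  In this form the closure properties
are immediate. *)
Definition cover_coefs S p : Prop :=
  forall k m, m \in msupp p`_k -> k_cover S k m.

Lemma cover_coefs_linear S (a : {mpoly K[n]}) p q :
  cover_coefs S p -> cover_coefs S q -> cover_coefs S (a *: p + q).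
Proof.
move=> Sp Sq k m; rewrite coefD coefZ => /msuppD_le; rewrite mem_cat.
case/orP => [/msuppM_le/allpairsP[[m1 m2] /= [_ /Sp km ->]]|/Sq //].
by rewrite -[k]add0n; apply: k_coverD (k_cover0 _ _) km.
Qed.

Lemma cover_coefs0 S : cover_coefs S 0.
Proof. by move=> k m; rewrite coef0 msupp0. Qed.

Lemma cover_coefsD S p q :
  cover_coefs S p -> cover_coefs S q -> cover_coefs S (p + q).
Proof. by rewrite -[p in p + q]scale1r; apply: cover_coefs_linear. Qed.

Lemma cover_coefsM S p q :
  cover_coefs S p -> cover_coefs S q -> cover_coefs S (p * q).
Proof.
move=> Sp Sq k m; rewrite coefM; move: m.
pose P (r : {mpoly K[n]}) := forall m, m \in msupp r -> k_cover S k m.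
apply: (big_ind P) => [m|u v Su Sv m|i _ m]; first by rewrite msupp0.
  by move=> /msuppD_le; rewrite mem_cat => /orP[/Su|/Sv].
move=> /msuppM_le/allpairsP[[m1 m2] /= [/Sp k1 /Sq k2 ->]].
by have := k_coverD k1 k2; rewrite subnKC // -ltnS.
Qed.

Lemma component_coefs S k p : cover_component S k p -> cover_coefs S p.
Proof.
case=> s /allP sk ->; rewrite big_seq; apply: big_ind.
- exact: cover_coefs0.
- exact: cover_coefsD.
move=> x /sk xk j m; rewrite coefZ coefXn.
case: eqP => [->|_]; last by rewrite mulr0 msupp0.
by rewrite mulr1 => /msuppZ_le; rewrite msuppX inE => /eqP->.
Qed.

Lemma vertex_cover_algebraP S p : vertex_cover_algebra S p <-> cover_coefs S p.
Proof.
split=> [[N [q [qS ->]]]|Sp].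
  apply: big_ind => [||i _]; [exact: cover_coefs0 | exact: cover_coefsD |].
  exact: component_coefs (qS i).
exists (size p), (fun k => p`_k *: 'X^k); split=> [k|]; last first.
  by rewrite -poly_def coefK.
exists [seq ((p`_k)@_m, m) | m <- msupp p`_k].
  by rewrite all_map; apply/allP => m /Sp.
by rewrite big_map -scaler_suml -mpolyE.
Qed.

Lemma generated_coefs S p :
  generated_subalgebra (cover_component S 1) p -> cover_coefs S p.
Proof.
elim=> [u /component_coefs // | | a u v _ Su _ Sv | u v _ Su _ Sv].
- move=> k m; rewrite coef1; case: k => [|k]; first by rewrite k_cover0.
  by rewrite msupp0.
- exact: cover_coefs_linear.
- exact: cover_coefsM.
Qed.

(** Every vertex cover contains a minimal one, so the facets of the dual complex
control all vertex covers. *)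
Lemma dual_coverP D k (c : 'X_{1..n}) C :
  k_cover (dual_complex D) k c -> vertex_cover D C -> (k <= weight c C)%N.
Proof.
move=> /forall_inP ck /minset_exists[C0 minC0 sC0].
have C0D : C0 \in facets (dual_complex D) by rewrite facets_dual inE.
apply: leq_trans (ck C0 C0D) _.
by rewrite /weight [X in (_ <= X)%N](big_setID C0) /= (setIidPr sC0) leq_addr.
Qed.

Definition mnm_set (F : {set 'I_n}) : 'X_{1..n} :=
  [multinom (i \in F : nat) | i < n].

Lemma facet_component D F : F \in facets D ->
  cover_component (dual_complex D) 1 ('X_[mnm_set F] *: 'X : {poly {mpoly K[n]}}).
Proof.
move=> FD; exists [:: (1, mnm_set F)]; last by rewrite big_seq1 scale1r expr1.
rewrite /= andbT; apply/forall_inP => C.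
rewrite facets_dual inE => /minsetp/forall_inP/(_ F FD)/set0Pn[x].
by rewrite inE => /andP[xC xF]; rewrite (bigD1 x) //= mnmE xF.
Qed.

Lemma generated0 S : generated_subalgebra (cover_component (K := K) S 1) 0.
Proof.
have := gen_linear (-1) (gen_one (cover_component (K := K) S 1)) (gen_one _).
by rewrite scaleN1r addNr.
Qed.

Lemma generatedZ S a p : generated_subalgebra (cover_component S 1) p ->
  generated_subalgebra (cover_component S 1) (a *: p).
Proof.
by move=> Sp; rewrite -[_ *: _]addr0; apply: gen_linear => //; apply: generated0.
Qed.

Lemma generatedD S p q : generated_subalgebra (cover_component S 1) p ->
  generated_subalgebra (cover_component S 1) q ->
  generated_subalgebra (cover_component S 1) (p + q).
Proof. by rewrite -[p in p + q]scale1r; apply: gen_linear. Qed.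

Lemma facets_generated D (s : seq {set 'I_n}) : {subset s <= facets D} ->
  generated_subalgebra (cover_component (dual_complex D) 1)
    ('X_[\sum_(F <- s) mnm_set F] *: 'X^(size s) : {poly {mpoly K[n]}}).
Proof.
elim: s => [|F s IH] sD.
  by rewrite big_nil mpolyX0 scale1r expr0; apply: gen_one.
rewrite big_cons mpolyXD exprS -scalerA scalerAr scalerAl.
apply: gen_mul; first by apply/gen_mem/facet_component/sD; rewrite mem_head.
by apply: IH => G Gs; apply: sD; rewrite inE Gs orbT.
Qed.

(** The packed facets split off a monomial of degree [k] in [t]; what is left of
[c] is a coefficient in [S]. *)
Lemma cover_generated D k (c : 'X_{1..n}) : balanced (facets D) ->
  k_cover (dual_complex D) k c ->
  generated_subalgebra (cover_component (dual_complex D) 1)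
    ('X_[c] *: 'X^k : {poly {mpoly K[n]}}).
Proof.
move=> bal ck.
have F0 : set0 \notin facets D.
  by apply/negP => /facet_neq0; rewrite eqxx.
have [s [<- sD sc]] := packing bal F0 (fun C => dual_coverP ck (C := C)).
have sc' : (\sum_(F <- s) mnm_set F <= c)%MM.
  apply/mnm_lepP => i; rewrite mnm_sumE.
  by under eq_bigr => F _ do rewrite mnmE; apply: sc.
rewrite -(submK sc') mpolyXD -scalerA.
exact/generatedZ/facets_generated.
Qed.

End CoverAlgebra.

Theorem theorem2p5 (K : fieldType) (n : nat) (D : simplicial_complex n)
    (no_special_odd_cycle : ~ has_special_odd_cycle D) :
  standard_graded K (dual_complex D).
Proof.
have bal : balanced (facets D).
  move=> s v F [s2 [vi Fi] inc spec odds]; apply: no_special_odd_cycle.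
  exists s, v, F; split=> //; split=> // i; by have [] := inc i.
move=> p; split=> [[N [q [qS ->]]]|/generated_coefs/vertex_cover_algebraP //].
apply: big_ind => [||k _]; [exact: generated0 | exact: generatedD |].
have [s /allP sk ->] := qS k; rewrite big_seq.
apply: big_ind => [||x /sk xk]; [exact: generated0 | exact: generatedD |].
rewrite -mul_mpolyC -scalerA; exact/generatedZ/cover_generated.
Qed.
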